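(* Let $OABC$ be a tangential LEQ and let $\sigma,\tau$ be the associated quantities defined in the context. If $\sigma,\tau\in\{2,3,5,\frac54,\frac32\}$, then the incenter (the center of the incircle) of $OABC$ is an integer lattice point, i.e. belongs to $\mathbb Z^2$.
   Context: A quadrilateral $OABC$ is given by four points of the plane, no three colinear, such that the segments $OA,AB,BC,CO$ have no interior points of intersection; it may be convex or concave. The vertices $O,A,B,C$ are written in positive (counterclockwise) cyclic order and, if $OABC$ is concave, the labelling is chosen so that the reflex angle is at $B$. The lengths of $OA,AB,BC,CO$ are $a,b,c,d$. A lattice equable quadrilateral (LEQ) is a quadrilateral whose vertices lie on $\mathbb Z^2$ and whose area equals its perimeter. A quadrilateral is tangential if it has an incircle, i.e. a circle inside it tangent to its four sides (in the concave case, to the sides or their extensions); by Pitot's theorem this is equivalent to $a+c=b+d$. For a tangential LEQ $OABC$ define $$\sigma=\frac{ad+bc+2\delta\sqrt{abcd-4(a+c)^2}}{16+(a-b)^2},\qquad \tau=\frac{ab+cd-2\delta\sqrt{abcd-4(a+c)^2}}{16+(a-d)^2},$$ where $\delta=1$ if $B$ lies within the circumcircle of the triangle $OAC$, and $\delta=-1$ otherwise. *)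

(* Defs.v *)
From Stdlib Require Import Reals List ClassicalEpsilon.
Import ListNotations.
Open Scope R_scope.

Definition point : Type := (R * R)%type.

Definition distance (P Q : point) : R := dist_euc (fst P) (snd P) (fst Q) (snd Q).

(* (Q - P) x (S - T) and (Q - P) . (S - T). *)
Definition cross (P Q T S : point) : R :=
  (fst Q - fst P) * (snd S - snd T) - (snd Q - snd P) * (fst S - fst T).
Definition dot (P Q T S : point) : R :=
  (fst Q - fst P) * (fst S - fst T) + (snd Q - snd P) * (snd S - snd T).

Definition lattice_point (P : point) : Prop :=
  exists m n : Z, P = (IZR m, IZR n).

Definition on_line_at (P Q : point) (t : R) : point :=
  (fst P + t * (fst Q - fst P), snd P + t * (snd Q - snd P)).

Definition line (P Q X : point) : Prop := exists t, X = on_line_at P Q t.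
Definition segment (P Q X : point) : Prop :=
  exists t, 0 <= t <= 1 /\ X = on_line_at P Q t.
Definition open_segment (P Q X : point) : Prop :=
  exists t, 0 < t < 1 /\ X = on_line_at P Q t.

Definition collinear (P Q T : point) : Prop := cross P Q P T = 0.

Definition interiors_disjoint (P Q S T : point) : Prop :=
  forall X, ~ (open_segment P Q X /\ open_segment S T X).

Definition quadrilateral (O A B C : point) : Prop :=
  ~ collinear O A B /\ ~ collinear A B C /\
  ~ collinear B C O /\ ~ collinear C O A /\
  interiors_disjoint O A A B /\ interiors_disjoint O A B C /\
  interiors_disjoint O A C O /\ interiors_disjoint A B B C /\
  interiors_disjoint A B C O /\ interiors_disjoint B C C O.

(* Shoelace formula, positive exactly for the counterclockwise order. *)
Definition signed_area (O A B C : point) : R :=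
  (  (fst O * snd A - fst A * snd O) + (fst A * snd B - fst B * snd A)
   + (fst B * snd C - fst C * snd B) + (fst C * snd O - fst O * snd C)) / 2.

Definition area (O A B C : point) : R := Rabs (signed_area O A B C).

Definition perimeter (O A B C : point) : R :=
  distance O A + distance A B + distance B C + distance C O.

(* For a counterclockwise simple polygon, the interior angle at Q, between the
   consecutive edges PQ and QT, exceeds pi exactly when one turns right at Q. *)
Definition reflex (P Q T : point) : Prop := cross P Q Q T < 0.

Definition concave (O A B C : point) : Prop :=
  reflex C O A \/ reflex O A B \/ reflex A B C \/ reflex B C O.

Definition well_labelled (O A B C : point) : Prop :=
  0 < signed_area O A B C /\ (concave O A B C -> reflex A B C).

Definition LEQ (O A B C : point) : Prop :=
  quadrilateral O A B C /\ well_labelled O A B C /\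
  lattice_point O /\ lattice_point A /\ lattice_point B /\ lattice_point C /\
  area O A B C = perimeter O A B C.

Definition in_triangle (P Q T X : point) : Prop :=
  exists u v w, 0 <= u /\ 0 <= v /\ 0 <= w /\ u + v + w = 1 /\
    X = (u * fst P + v * fst Q + w * fst T, u * snd P + v * snd Q + w * snd T).

(* The closed region bounded by a well-labelled quadrilateral: as a reflex angle
   can only be at B, the diagonal OB lies inside and cuts it into two triangles. *)
Definition region (O A B C X : point) : Prop :=
  in_triangle O A B X \/ in_triangle O B C X.

(* The circle of centre I and radius r is tangent to the line PQ, at a point
   belonging to S P Q, where S is [segment] or [line]. *)
Definition tangent_on (S : point -> point -> point -> Prop)
    (I : point) (r : R) (P Q : point) : Prop :=
  exists T, S P Q T /\ distance I T = r /\ dot I T P Q = 0.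

Definition tangent_to_all (S : point -> point -> point -> Prop)
    (O A B C I : point) (r : R) : Prop :=
  tangent_on S I r O A /\ tangent_on S I r A B /\
  tangent_on S I r B C /\ tangent_on S I r C O.

Definition is_incircle (O A B C I : point) (r : R) : Prop :=
  0 < r /\
  (forall X, distance I X = r -> region O A B C X) /\
  (~ concave O A B C -> tangent_to_all segment O A B C I r) /\
  (concave O A B C -> tangent_to_all line O A B C I r).

Definition is_incenter (O A B C I : point) : Prop :=
  exists r, is_incircle O A B C I r.

Definition tangential (O A B C : point) : Prop :=
  exists I r, is_incircle O A B C I r.

Definition within_circumcircle (P Q T X : point) : Prop :=
  exists W, distance W P = distance W Q /\ distance W P = distance W T /\
    distance W X < distance W P.

Definition leq_delta (O A B C : point) : R :=
  if excluded_middle_informative (within_circumcircle O A C B) then 1 else -1.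

Definition leq_sigma (O A B C : point) : R :=
  let a := distance O A in let b := distance A B in
  let c := distance B C in let d := distance C O in
  (a * d + b * c
     + 2 * leq_delta O A B C * sqrt (a * b * c * d - 4 * (a + c) ^ 2))
  / (16 + (a - b) ^ 2).

Definition leq_tau (O A B C : point) : R :=
  let a := distance O A in let b := distance A B in
  let c := distance B C in let d := distance C O in
  (a * b + c * d
     - 2 * leq_delta O A B C * sqrt (a * b * c * d - 4 * (a + c) ^ 2))
  / (16 + (a - d) ^ 2).

(* Main.v *)
(* Since area equals perimeter, the incircle has radius 2. Let x, y be the tangent
   lengths at O and B, signed so that adjacent ones add up to the side even in the
   concave case, and put k = ad / (x^2 + 4). Computing AC^2 and the area from the
   triangles OAC and BCA gives k = bc / (y^2 + 4) and k (x + y) = a + c, whence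
   abcd - 4 (a + c)^2 = k^2 (xy - 4)^2; the in-circle determinant of O, A, C, B has
   the sign of xy - 4, so delta removes the absolute value and sigma = k. In complex
   numbers with origin O this reads sigma I^2 = AC and sigma |I|^2 = ad. The sides
   are integers, as a, c (and b, d) have integer squares and rational sum, so I has
   rational coordinates, and 2 sigma times the square of each is an integer. For
   sigma = 3, 5, 5/4, 3/2 squarefreeness of 6 and 10 forces integer coordinates. For
   sigma = 2 the coordinates of 2I are integers of equal parity, and both odd is
   impossible by a descent modulo 2 on cross(A, 2I) = 4a, |A| = a. *)
Require Import Defs.
From Stdlib Require Import Reals List ClassicalEpsilon.
From Stdlib Require Import Psatz ZArith QArith Qcanon Qreals Znumtheory.
Import ListNotations.
Open Scope R_scope.

(** * Distances and the Lagrange identity for cross and dot products *)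

Lemma distance_pos P Q : 0 <= distance P Q.
Proof. apply sqrt_pos. Qed.

Lemma distance_sqr P Q : distance P Q ^ 2 = dot P Q P Q.
Proof.
  unfold distance, dist_euc, dot. rewrite pow2_sqrt by (apply Rplus_le_le_0_compat; apply Rle_0_sqr). unfold Rsqr; ring.
Qed.

Lemma distance_sym P Q : distance P Q = distance Q P.
Proof. apply distance_symm. Qed.

Lemma distance_gt0 P Q : distance P Q <> 0 -> 0 < distance P Q.
Proof. pose proof (distance_pos P Q); lra. Qed.

Lemma cross_sqr P Q S T :
  cross P Q S T ^ 2 + dot P Q S T ^ 2 = (distance P Q * distance S T) ^ 2.
Proof.
  rewrite Rpow_mult_distr, !distance_sqr. unfold cross, dot; ring.
Qed.

Lemma not_collinear_distance P Q T :
  ~ collinear P Q T -> 0 < distance P Q /\ 0 < distance P T.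
Proof.
  unfold collinear; intros H.
  pose proof (cross_sqr P Q P T) as E.
  split; apply distance_gt0; intros Z; apply H; rewrite Z in E; nra.
Qed.

(** * Tangent lines and half-planes *)

Lemma tangent_segment_line I r P Q :
  tangent_on segment I r P Q -> tangent_on line I r P Q.
Proof.
  intros (T & (t & _ & Ht) & H); exists T; split; [now exists t | exact H].
Qed.

(** The radius [I T] is orthogonal to [P Q], so the Lagrange identity leaves only the cross product,
    which does not change up to sign when [T] moves along the line to [P]. Squares appear because
    tangency alone does not tell on which side [I] lies. *)
Lemma tangent_cross_sqr I r P Q :
  tangent_on line I r P Q -> cross P Q P I ^ 2 = (r * distance P Q) ^ 2.
Proof.
  intros (T & (t & HT) & Hr & Hd).
  rewrite Rpow_mult_distr, <- Hr, !distance_sqr.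
  pose proof (cross_sqr I T P Q) as E.
  rewrite Hd, Rpow_mult_distr, !distance_sqr in E.
  rewrite <- E. subst T. destruct P, Q, I; unfold cross, on_line_at; simpl; ring.
Qed.

Lemma circle_in_half_plane I r P Q :
  0 < distance P Q ->
  (forall X, distance I X = r -> 0 <= cross P Q P X) ->
  0 < r -> r * distance P Q <= cross P Q P I.
Proof.
  intros HPQ H Hr.
  set (l := distance P Q) in *.
  assert (Hl : l ^ 2 = dot P Q P Q) by apply distance_sqr.
  (* [X] is the point of the circle farthest to the right of the directed line [P Q]; its cross
     product is that of [I] minus [r * l]. *)
  set (X := (fst I + r * (snd Q - snd P) / l, snd I - r * (fst Q - fst P) / l)).
  assert (HX : distance I X = r).
  { unfold distance, dist_euc, X; simpl.
    replace (_ + _) with (r ^ 2 * (dot P Q P Q / l ^ 2))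
      by (unfold Rsqr, dot; field; lra).
    rewrite <- Hl. replace (r ^ 2 * (l ^ 2 / l ^ 2)) with (r ^ 2) by (field; lra).
    apply sqrt_pow2; lra. }
  apply H in HX.
  replace (cross P Q P X) with (cross P Q P I - r * dot P Q P Q / l) in HX
    by (unfold cross, dot, X; simpl; field; lra).
  rewrite <- Hl in HX. replace (r * l ^ 2 / l) with (r * l) in HX by (field; lra).
  lra.
Qed.

(* If I were on the other side of VQ, T would lie on VQ and hence be V, and the
   radius at V would be orthogonal to both VP and VQ. *)
Lemma tangent_lines_same_side V P Q I T r l :
  0 < r -> 0 <= l -> T = on_line_at V P l ->
  distance I T = r -> dot I T V P = 0 ->
  cross V Q V I ^ 2 = (r * distance V Q) ^ 2 ->
  cross V Q V P <> 0 ->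
  0 < cross V Q V P * cross V Q V I.
Proof.
  intros Hr Hl HT Hd Hp Hc Hn.
  destruct (not_collinear_distance V Q P Hn) as [Hq _].
  assert (Hw : cross V Q V I <> 0).
  { intros Z; rewrite Z in Hc. assert (0 < r * distance V Q) by nra. nra. }
  apply Rnot_le_lt; intros Hs.
  pose proof (cross_sqr V Q I T) as E. rewrite Hd in E.
  assert (E1 : cross V Q V T = l * cross V Q V P)
    by (subst T; unfold cross, on_line_at; simpl; ring).
  assert (E2 : cross V Q V T = cross V Q V I + cross V Q I T)
    by (unfold cross; ring).
  assert (E3 : l * cross V Q V P * cross V Q V I <= 0) by nra.
  rewrite <- E1, E2 in E3.
  set (g := cross V Q I T) in *. set (w := cross V Q V I) in *.
  assert (Hgw : g ^ 2 <= w ^ 2) by nra.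
  assert (Hg : g = - w) by nra.
  assert (Hh : dot V Q I T = 0) by (rewrite Hg in E; nra).
  assert (l0 : l = 0).
  { assert (l * cross V Q V P = 0) as Z by lra.
    apply Rmult_integral in Z; tauto. }
  apply Hn.
  assert (Hrr : dot I T I T = r ^ 2) by (rewrite <- distance_sqr, Hd; ring).
  assert (Z : cross V Q V P * dot I T I T
      = cross V Q I T * dot I T V P - dot V Q I T * cross V P I T)
    by (unfold cross, dot; ring).
  rewrite Hp, Hh, Hrr in Z.
  assert (0 < r ^ 2) by nra. nra.
Qed.

(** * Orientation of the quadrilateral and its region *)

(** An affine function with values [x], [y] of opposite signs at the ends of a segment vanishes at
    parameter [x / (x - y)], strictly between 0 and 1. The two parameters so obtained describe the
    same point. *)
Lemma opposite_sides_meet P Q S T :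
  cross P Q P S * cross P Q P T < 0 -> cross S T S P * cross S T S Q < 0 ->
  ~ interiors_disjoint P Q S T.
Proof.
  intros H1 H2 H.
  assert (Hpar : forall x y, x * y < 0 -> x - y <> 0 /\ 0 < x / (x - y) < 1).
  { intros x y Hxy. assert (x - y <> 0) by nra. split; [easy|].
    assert (0 < (x - y) ^ 2) by nra.
    replace (x / (x - y)) with ((x ^ 2 - x * y) / (x - y) ^ 2) by (field; easy).
    split; [apply Rdiv_lt_0_compat; nra|].
    apply Rmult_lt_reg_r with ((x - y) ^ 2); [easy|].
    unfold Rdiv; rewrite Rmult_assoc, Rinv_l; nra. }
  destruct (Hpar _ _ H1) as [N1 B1], (Hpar _ _ H2) as [N2 B2].
  set (s := _ / _) in B1 at 1. set (t := _ / _) in B2 at 1.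
  apply (H (on_line_at P Q t)). split; [now exists t|].
  exists s; split; [easy|].
  unfold s, t, on_line_at.
  assert (N : cross P Q S T <> 0).
  { replace (cross P Q S T) with (- (cross P Q P S - cross P Q P T))
      by (unfold cross; ring). lra. }
  replace (cross P Q P S - cross P Q P T) with (- cross P Q S T)
    by (unfold cross; ring).
  replace (cross S T S P - cross S T S Q) with (cross P Q S T)
    by (unfold cross; ring).
  f_equal; unfold cross in *; field; lra.
Qed.

Lemma turn_cycle P Q T : cross P Q P T = cross Q T Q P.
Proof. unfold cross; ring. Qed.

Lemma turn_swap P Q T : cross P Q P T = - cross Q P Q T.
Proof. unfold cross; ring. Qed.

(** If [B] is not reflex, the labelling makes every turn nonnegative, and noncollinearity makes it
    positive. If [B] is reflex, splitting the positive area along [AC] gives the turn at [O]; a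
    negative turn at [A] would make [OA] meet [BC], and one at [C] would make [AB] meet [CO]. *)
Lemma positive_turns O A B C :
  quadrilateral O A B C -> well_labelled O A B C ->
  0 < cross O A O B /\ 0 < cross O B O C /\ 0 < cross O A O C.
Proof.
  unfold quadrilateral, collinear.
  intros (n1 & n2 & n3 & n4 & _ & d1 & _ & _ & d2 & _) (Ha & Hc).
  unfold concave, reflex in Hc.
  replace (cross O A A B) with (cross O A O B) in Hc by (unfold cross; ring).
  replace (cross A B B C) with (cross A B A C) in Hc by (unfold cross; ring).
  replace (cross B C C O) with (cross O B O C) in Hc by (unfold cross; ring).
  replace (cross C O O A) with (cross O A O C) in Hc by (unfold cross; ring).
  replace (cross B C B O) with (cross O B O C) in n3 by (unfold cross; ring).
  replace (cross C O C A) with (cross O A O C) in n4 by (unfold cross; ring).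
  assert (E1 : signed_area O A B C = (cross O A O B + cross O B O C) / 2)
    by (unfold signed_area, cross; field).
  assert (E2 : cross O A O B + cross O B O C = cross O A O C + cross A B A C)
    by (unfold cross; ring).
  destruct (Rlt_dec (cross A B A C) 0) as [HB | HB].
  2:{ destruct (Rlt_dec (cross O A O B) 0), (Rlt_dec (cross O B O C) 0),
        (Rlt_dec (cross O A O C) 0); try (exfalso; tauto); lra. }
  assert (0 < cross O A O C) by lra.
  destruct (Rlt_dec (cross O A O B) 0).
  { exfalso. revert d1. apply opposite_sides_meet; [nra|].
    replace (cross B C B O) with (cross O B O C) by (unfold cross; ring).
    replace (cross B C B A) with (cross A B A C) by (unfold cross; ring). nra. }
  destruct (Rlt_dec (cross O B O C) 0).
  { exfalso. revert d2. apply opposite_sides_meet.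
    - replace (cross A B A O) with (cross O A O B) by (unfold cross; ring). nra.
    - replace (cross C O C A) with (cross O A O C) by (unfold cross; ring).
      replace (cross C O C B) with (cross O B O C) by (unfold cross; ring). nra. }
  lra.
Qed.

(** In barycentric coordinates both cross products are nonnegative combinations of the three turns.
    The equality cases say that the region touches the lines [OA] and [CO] only on the rays from [A]
    and [C] through [O]; this locates the contact points of the incircle. *)
Lemma region_turns O A B C X :
  0 < cross O A O B -> 0 < cross O B O C -> 0 < cross O A O C ->
  region O A B C X ->
  (0 <= cross O A O X /\
   (cross O A O X = 0 -> exists l, 0 <= l /\ X = on_line_at A O l)) /\
  (0 <= cross C O C X /\
   (cross C O C X = 0 -> exists l, 0 <= l /\ X = on_line_at C O l)).
Proof.
  intros H1 H2 H3 [(u & v & w & Hu & Hv & Hw & Hs & HX)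
                  |(u & v & w & Hu & Hv & Hw & Hs & HX)];
  replace u with (1 - v - w) in * by lra.
  - assert (E1 : cross O A O X = w * cross O A O B)
      by (rewrite HX; unfold cross; simpl; ring).
    assert (E2 : cross C O C X = v * cross O A O C + w * cross O B O C)
      by (rewrite HX; unfold cross; simpl; ring).
    rewrite E1, E2. split; split; try nra; intros Z.
    + assert (w = 0) by nra. exists (1 - v). split; [lra|].
      rewrite HX; unfold on_line_at. subst w. f_equal; ring.
    + assert (w = 0) by nra. assert (v = 0) by nra. exists 1. split; [lra|].
      rewrite HX; unfold on_line_at. subst w v. f_equal; ring.
  - assert (E1 : cross O A O X = v * cross O A O B + w * cross O A O C)
      by (rewrite HX; unfold cross; simpl; ring).
    assert (E2 : cross C O C X = v * cross O B O C)
      by (rewrite HX; unfold cross; simpl; ring).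
    rewrite E1, E2. split; split; try nra; intros Z.
    + assert (w = 0) by nra. assert (v = 0) by nra. exists 1. split; [lra|].
      rewrite HX; unfold on_line_at. subst w v. f_equal; ring.
    + assert (v = 0) by nra. exists (1 - w). split; [lra|].
      rewrite HX; unfold on_line_at. subst v. f_equal; ring.
Qed.

(** * Signed distances from the incenter to the sides *)

Lemma eq_of_sqr x y : 0 < x -> 0 <= y -> x ^ 2 = y ^ 2 -> x = y.
Proof. intros; nra. Qed.

(** Only signs remain to be found. For [OA] and [CO] they follow from the circle lying in a
    half-plane. This fails for [AB] and [BC] when [B] is reflex; there the contact point of [OA] (or
    [CO]) lies on the ray through [O], which puts [I] on the same side as [O]. *)
Lemma incenter_offsets O A B C I r :
  quadrilateral O A B C -> well_labelled O A B C -> is_incircle O A B C I r ->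
  cross O A O I = r * distance O A /\ cross A B A I = r * distance A B /\
  cross B C B I = r * distance B C /\ cross C O C I = r * distance C O.
Proof.
  intros Hq Hw (Hr & Hreg & Hconv & Hconc).
  assert (Ht : tangent_to_all line O A B C I r).
  { destruct (excluded_middle_informative (concave O A B C)) as [H | H]; [now auto|].
    destruct (Hconv H) as (h1 & h2 & h3 & h4).
    repeat split; now apply tangent_segment_line. }
  destruct (positive_turns O A B C Hq Hw) as (P1 & P2 & P3).
  destruct Ht as (t1 & t2 & t3 & t4).
  assert (Hside := fun X HX =>
    region_turns O A B C X P1 P2 P3 (Hreg X HX)).
  assert (dOA : 0 < distance O A) by (apply (not_collinear_distance O A B); unfold collinear; lra).
  assert (dCO : 0 < distance C O).
  { apply (not_collinear_distance C O A). unfold collinear.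
    rewrite <- turn_cycle. unfold cross in *; lra. }
  assert (Hsgn : forall P Q, tangent_on line I r P Q -> 0 < cross P Q P I ->
            cross P Q P I = r * distance P Q).
  { intros P Q H H'. apply eq_of_sqr; [easy | | now apply tangent_cross_sqr].
    pose proof (distance_pos P Q); nra. }
  assert (Hpos : forall P Q, 0 < distance P Q ->
            (forall X, distance I X = r -> 0 <= cross P Q P X) -> 0 < cross P Q P I).
  { intros P Q Hd H. pose proof (circle_in_half_plane I r P Q Hd H Hr). nra. }
  repeat split; apply Hsgn; try easy.
  - apply Hpos; [easy|]. intros X HX; now destruct (Hside X HX).
  - destruct t1 as (T & (s & HT) & Hd & Hp).
    destruct (Hside T Hd) as [[_ [l [Hl HTl]]] _].
    { rewrite HT. unfold cross, on_line_at; simpl; ring. }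
    assert (N : 0 < cross A B A O) by (rewrite <- turn_cycle; easy).
    enough (0 < cross A B A O * cross A B A I) by nra.
    apply (tangent_lines_same_side A O B I T r l); try easy; [| |lra].
    + unfold dot in *; lra.
    + now apply tangent_cross_sqr.
  - destruct t4 as (T & (s & HT) & Hd & Hp).
    destruct (Hside T Hd) as [_ [_ [l [Hl HTl]]]].
    { rewrite HT. unfold cross, on_line_at; simpl; ring. }
    assert (N : cross C B C O < 0) by (unfold cross in *; lra).
    rewrite turn_swap.
    enough (0 < cross C B C O * cross C B C I) by nra.
    apply (tangent_lines_same_side C O B I T r l); try easy; [|lra].
    replace (cross C B C I ^ 2) with (cross B C B I ^ 2) by (unfold cross; ring).
    rewrite (distance_sym C B). now apply tangent_cross_sqr.
  - apply Hpos; [easy|]. intros X HX; now destruct (Hside X HX).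
Qed.

(** * Signed tangent lengths at the vertices *)

(* At a vertex the tangent lengths, signed by dot products, have equal squares;
   opposite signs would force the two sides to be collinear. *)
Lemma tangent_lengths_agree V P Q I r :
  0 < r -> ~ collinear V P Q ->
  cross V P V I = r * distance V P -> cross V I V Q = r * distance V Q ->
  exists t, dot V P V I = t * distance V P /\ dot V Q V I = t * distance V Q /\
            dot V I V I = t ^ 2 + r ^ 2.
Proof.
  intros Hr Hn Hp Hq.
  destruct (not_collinear_distance V P Q Hn) as [dp dq].
  set (a := distance V P) in *. set (d := distance V Q) in *.
  exists (dot V P V I / a).
  pose proof (cross_sqr V P V I) as E1. pose proof (cross_sqr V I V Q) as E2.
  rewrite Rpow_mult_distr, (distance_sqr V I) in E1, E2. fold a in E1. fold d in E2.
  rewrite Hp in E1. rewrite Hq in E2.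
  replace (dot V I V Q) with (dot V Q V I) in E2 by (unfold dot; ring).
  set (t := dot V P V I / a). set (t' := dot V Q V I / d).
  assert (Ht : dot V P V I = t * a) by (unfold t; field; lra).
  assert (Ht' : dot V Q V I = t' * d) by (unfold t'; field; lra).
  rewrite Ht in E1. rewrite Ht' in E2.
  assert (F1 : dot V I V I = t ^ 2 + r ^ 2).
  { apply Rmult_eq_reg_l with (a ^ 2); nra. }
  assert (F2 : dot V I V I = t' ^ 2 + r ^ 2).
  { apply Rmult_eq_reg_l with (d ^ 2); nra. }
  split; [easy | split; [|easy]].
  rewrite Ht'. f_equal.
  assert (Hs : (t' - t) * (t' + t) = 0) by lra.
  apply Rmult_integral in Hs. destruct Hs as [Hs | Hs]; [lra|].
  exfalso. apply Hn. unfold collinear.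
  assert (Hk : dot V I V I * cross V P V Q
      = cross V P V I * dot V Q V I + dot V P V I * cross V I V Q)
    by (unfold dot, cross; ring).
  rewrite Hp, Hq, Ht, Ht' in Hk. replace t' with (- t) in Hk by lra.
  assert (Hz : dot V I V I * cross V P V Q = 0) by (rewrite Hk; ring).
  apply Rmult_integral in Hz. destruct Hz as [Hz | Hz]; [|easy].
  rewrite Hz in F1. assert (0 < r ^ 2) by nra. nra.
Qed.

(* With I - V = z, the two side vectors at V are |VP| z / (t + 2i) and
   |VQ| z / (t - 2i) in complex notation, so that (P - V)(Q - V) = k z^2; the
   last equation is the real part of this. *)
Lemma vertex_relations V P Q I t :
  let k := distance V P * distance V Q / (t ^ 2 + 4) in
  cross V P V I = 2 * distance V P -> cross V I V Q = 2 * distance V Q ->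
  dot V P V I = t * distance V P -> dot V Q V I = t * distance V Q ->
  dot V I V I = t ^ 2 + 4 ->
  dot V P V Q = k * (t ^ 2 - 4) /\ cross V P V Q = 4 * k * t /\
  (fst P - fst V) * (fst Q - fst V) - (snd P - snd V) * (snd Q - snd V)
    = k * ((fst I - fst V) ^ 2 - (snd I - snd V) ^ 2).
Proof.
  intros k.
  set (a := distance V P) in *. set (d := distance V Q) in *.
  unfold cross, dot.
  set (p1 := fst P - fst V). set (p2 := snd P - snd V).
  set (q1 := fst Q - fst V). set (q2 := snd Q - snd V).
  set (i1 := fst I - fst V). set (i2 := snd I - snd V).
  intros Hcp Hcq Hdp Hdq Hi.
  assert (N : t ^ 2 + 4 <> 0) by nra.
  assert (Hp1 : p1 = a * (t * i1 + 2 * i2) / (t ^ 2 + 4)).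
  { apply Rmult_eq_reg_r with (t ^ 2 + 4); [|easy]. unfold Rdiv.
    rewrite Rmult_assoc, Rinv_l, <- Hi by easy.
    replace (_ * (_ + _) * 1) with ((t * a) * i1 + (2 * a) * i2) by ring.
    rewrite <- Hdp, <- Hcp. ring. }
  assert (Hp2 : p2 = a * (t * i2 - 2 * i1) / (t ^ 2 + 4)).
  { apply Rmult_eq_reg_r with (t ^ 2 + 4); [|easy]. unfold Rdiv.
    rewrite Rmult_assoc, Rinv_l, <- Hi by easy.
    replace (_ * (_ - _) * 1) with ((t * a) * i2 - (2 * a) * i1) by ring.
    rewrite <- Hdp, <- Hcp. ring. }
  assert (Hq1 : q1 = d * (t * i1 - 2 * i2) / (t ^ 2 + 4)).
  { apply Rmult_eq_reg_r with (t ^ 2 + 4); [|easy]. unfold Rdiv.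
    rewrite Rmult_assoc, Rinv_l, <- Hi by easy.
    replace (_ * (_ - _) * 1) with ((t * d) * i1 - (2 * d) * i2) by ring.
    rewrite <- Hdq, <- Hcq. ring. }
  assert (Hq2 : q2 = d * (t * i2 + 2 * i1) / (t ^ 2 + 4)).
  { apply Rmult_eq_reg_r with (t ^ 2 + 4); [|easy]. unfold Rdiv.
    rewrite Rmult_assoc, Rinv_l, <- Hi by easy.
    replace (_ * (_ + _) * 1) with ((t * d) * i2 + (2 * d) * i1) by ring.
    rewrite <- Hdq, <- Hcq. ring. }
  clearbody p1 p2 q1 q2 i1 i2. clear Hcp Hcq Hdp Hdq.
  subst p1 p2 q1 q2. unfold k; clear k.
  repeat split.
  - replace (_ + _) with
      (a * d * (t ^ 2 - 4) * (i1 * i1 + i2 * i2) / (t ^ 2 + 4) ^ 2)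
      by (field; easy).
    rewrite Hi. field; easy.
  - replace (_ - _) with
      (a * d * 4 * t * (i1 * i1 + i2 * i2) / (t ^ 2 + 4) ^ 2)
      by (field; easy).
    rewrite Hi. field; easy.
  - field; easy.
Qed.

Lemma side_length P Q I s t :
  0 < distance P Q -> dot P Q P I = s * distance P Q ->
  dot Q P Q I = t * distance P Q -> distance P Q = s + t.
Proof.
  intros Hd Hs Ht. pose proof (distance_sqr P Q) as E.
  assert (dot P Q P Q = dot P Q P I + dot Q P Q I) by (unfold dot; ring).
  nra.
Qed.

(** * The circumcircle test and the value of [leq_sigma] *)

(* The in-circle determinant of B for the triangle OAC. *)
Lemma within_circumcircle_iff O A B C :
  0 < cross O A O C ->
  within_circumcircle O A C B <->
  cross O A O C * dot B C B A + cross B C B A * dot O A O C < 0.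
Proof.
  intros Hp.
  set (D := _ + _).
  (* The power of [B] with respect to the circle through [O], [A], [C], scaled by the positive cross
     product, is the determinant. *)
  assert (Hpow : forall W, distance W O = distance W A -> distance W O = distance W C ->
     (distance W B ^ 2 - distance W O ^ 2) * cross O A O C = D).
  { intros W HA HC.
    assert (EA : distance W O ^ 2 = distance W A ^ 2) by now rewrite HA.
    assert (EC : distance W O ^ 2 = distance W C ^ 2) by now rewrite HC.
    rewrite !distance_sqr in *.
    assert (E : (dot W B W B - dot W O W O) * cross O A O C - D
       = (dot W A W A - dot W O W O) * cross O B O C
         + (dot W C W C - dot W O W O) * cross O A O B)
      by (unfold D, dot, cross; ring).
    rewrite <- EA, <- EC in E. lra. }
  split.
  - intros (W & HA & HC & HB). rewrite <- (Hpow W HA HC).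
    pose proof (distance_pos W B).
    assert (distance W B ^ 2 < distance W O ^ 2) by nra. nra.
  - intros HD.
    (* [W] is the circumcenter of [OAC], obtained by Cramer's rule from the perpendicular bisectors
       of [OA] and [OC]. *)
    set (W := (fst O + (dot O A O A * (snd C - snd O) - dot O C O C * (snd A - snd O))
                         / (2 * cross O A O C),
               snd O + (dot O C O C * (fst A - fst O) - dot O A O A * (fst C - fst O))
                         / (2 * cross O A O C))).
    assert (Heq : forall X, dot W O W O = dot W X W X -> distance W O = distance W X).
    { intros X HX. rewrite <- !distance_sqr in HX.
      pose proof (distance_pos W O). pose proof (distance_pos W X). nra. }
    assert (HA : distance W O = distance W A).
    { apply Heq. unfold W, dot; simpl. unfold cross in *. field. lra. }
    assert (HC : distance W O = distance W C).
    { apply Heq. unfold W, dot; simpl. unfold cross in *. field. lra. }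
    exists W. repeat split; try easy.
    rewrite <- (Hpow W HA HC) in HD.
    pose proof (distance_pos W O). pose proof (distance_pos W B).
    assert (distance W B ^ 2 < distance W O ^ 2) by nra. nra.
Qed.

Lemma sigma_eq O A B C k x y :
  0 < k -> 0 < x + y -> 0 < cross O A O C ->
  distance O A * distance C O = k * (x ^ 2 + 4) ->
  distance A B * distance B C = k * (y ^ 2 + 4) ->
  distance O A - distance A B = x - y ->
  distance O A + distance B C = k * (x + y) ->
  cross O A O C = 4 * k * x -> dot O A O C = k * (x ^ 2 - 4) ->
  cross B C B A = 4 * k * y -> dot B C B A = k * (y ^ 2 - 4) ->
  leq_sigma O A B C = k.
Proof.
  intros Hk Hxy Hpos Had Hbc Hab Hac c1 d1 c2 d2.
  pose proof (within_circumcircle_iff O A B C Hpos) as Hin.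
  rewrite c1, d1, c2, d2 in Hin.
  (* The determinant factors as a positive number times [x * y - 4]. *)
  replace (4 * k * x * (k * (y ^ 2 - 4)) + 4 * k * y * (k * (x ^ 2 - 4)))
    with (4 * k ^ 2 * (x + y) * (x * y - 4)) in Hin by ring.
  assert (K : 0 < 4 * k ^ 2 * (x + y))
    by (repeat apply Rmult_lt_0_compat; lra || apply pow_lt; lra).
  unfold leq_sigma, leq_delta.
  rewrite Hab.
  replace (distance O A * distance A B * distance B C * distance C O
           - 4 * (distance O A + distance B C) ^ 2)
    with ((k * (x * y - 4)) ^ 2).
  2:{ replace (distance O A * distance A B * distance B C * distance C O)
        with ((distance O A * distance C O) * (distance A B * distance B C)) by ring.
      rewrite Had, Hbc, Hac. ring. }
  rewrite Had, Hbc.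
  assert (N : 16 + (x - y) ^ 2 <> 0) by (pose proof (pow2_ge_0 (x - y)); lra).
  rewrite <- (Rsqr_pow2 (k * (x * y - 4))), sqrt_Rsqr_abs.
  (* In both cases the root term becomes [- 2 * k * (x * y - 4)], so the numerator is
     [k * (16 + (x - y) ^ 2)]. *)
  destruct (excluded_middle_informative _) as [H | H].
  - assert (x * y - 4 < 0) by (apply Hin in H; nra).
    rewrite Rabs_left by nra. field. lra.
  - assert (0 <= x * y - 4).
    { apply Rnot_lt_le. intros L. apply H, Hin. nra. }
    rewrite Rabs_right by nra. field. lra.
Qed.

(** * Metric relations of the incenter *)

(** This collects all the geometry that the arithmetic needs; [t] is the tangent length at [O]. The
    last two equations are the modulus and the real part of the complex relation between [I], [A]
    and [C]. *)
Lemma incenter_relations O A B C I :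
  LEQ O A B C -> is_incenter O A B C I ->
  exists t, let s := leq_sigma O A B C in
    0 < s /\ 0 < distance O A /\ 0 < distance B C /\
    distance O A + distance B C = distance A B + distance C O /\
    2 * signed_area O A B C = 4 * (distance O A + distance B C) /\
    s * (2 * t - (distance O A - distance A B)) = distance O A + distance B C /\
    cross O A O I = 2 * distance O A /\ dot O A O I = t * distance O A /\
    s * dot O I O I = distance O A * distance C O /\
    (fst A - fst O) * (fst C - fst O) - (snd A - snd O) * (snd C - snd O)
      = s * ((fst I - fst O) ^ 2 - (snd I - snd O) ^ 2).
Proof.
  intros (Hq & Hw & _ & _ & _ & _ & Harea) (r & Hinc).
  destruct (positive_turns O A B C Hq Hw) as (_ & _ & P3).
  destruct (incenter_offsets O A B C I r Hq Hw Hinc) as (h1 & h2 & h3 & h4).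
  destruct Hq as (n1 & n2 & n3 & n4 & _).
  destruct (not_collinear_distance _ _ _ n1) as [da _].
  destruct (not_collinear_distance _ _ _ n2) as [db _].
  destruct (not_collinear_distance _ _ _ n3) as [dc _].
  destruct (not_collinear_distance _ _ _ n4) as [dd _].
  assert (Hsum : 2 * signed_area O A B C
      = cross O A O I + cross A B A I + cross B C B I + cross C O C I)
    by (unfold signed_area, cross; field).
  unfold area, perimeter in Harea.
  rewrite Rabs_right in Harea by (destruct Hw; lra).
  (* The signed triangles from [I] over the sides give area [r / 2] times the perimeter, and the two
     are equal. *)
  assert (r = 2) as -> by nra.
  assert (m1 : ~ collinear O A C) by (unfold collinear in *; lra).
  assert (m2 : ~ collinear A B O) by (unfold collinear in *; now rewrite <- turn_cycle).
  assert (m3 : ~ collinear B C A) by (unfold collinear in *; now rewrite <- turn_cycle).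
  assert (m4 : ~ collinear C O B) by (unfold collinear in *; now rewrite <- turn_cycle).
  assert (Hback : forall P Q, cross P Q P I = 2 * distance P Q ->
             cross Q I Q P = 2 * distance Q P)
    by (intros P Q H; rewrite distance_sym, <- H; unfold cross; ring).
  destruct (tangent_lengths_agree O A C I 2 ltac:(lra) m1 h1 (Hback _ _ h4))
    as (x & x1 & x2 & x3).
  destruct (tangent_lengths_agree A B O I 2 ltac:(lra) m2 h2 (Hback _ _ h1))
    as (u & u1 & u2 & u3).
  destruct (tangent_lengths_agree B C A I 2 ltac:(lra) m3 h3 (Hback _ _ h2))
    as (y & y1 & y2 & y3).
  destruct (tangent_lengths_agree C O B I 2 ltac:(lra) m4 h4 (Hback _ _ h3))
    as (v & v1 & v2 & v3).
  replace (x ^ 2 + 2 ^ 2) with (x ^ 2 + 4) in x3 by ring.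
  replace (y ^ 2 + 2 ^ 2) with (y ^ 2 + 4) in y3 by ring.
  destruct (vertex_relations O A C I x h1 (Hback _ _ h4) x1 x2 x3)
    as (d1 & c1 & e1).
  destruct (vertex_relations B C A I y h3 (Hback _ _ h2) y1 y2 y3)
    as (d2 & c2 & _).
  rewrite (distance_sym A O) in u2. rewrite (distance_sym B A) in y2.
  rewrite (distance_sym C B) in v2. rewrite (distance_sym O C) in x2.
  rewrite (distance_sym O C) in *. rewrite (distance_sym B A) in *.
  assert (La := side_length O A I x u da x1 u2).
  assert (Lb := side_length A B I u y db u1 y2).
  assert (Lc := side_length B C I y v dc y1 v2).
  assert (Ld := side_length C O I v x dd v1 x2).
  set (k := distance O A * distance C O / (x ^ 2 + 4)) in *.
  set (k' := distance B C * distance A B / (y ^ 2 + 4)) in *.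
  assert (Hk : distance O A * distance C O = k * (x ^ 2 + 4)) by (unfold k; field; nra).
  assert (Hk' : distance A B * distance B C = k' * (y ^ 2 + 4)) by (unfold k'; field; nra).
  clearbody k k'.
  assert (kk : k' = k).
  { (* both triangles OAC and BAC compute the diagonal AC *)
    assert (E1 : dot A C A C = dot O A O A + dot O C O C - 2 * dot O A O C)
      by (unfold dot; ring).
    assert (E2 : dot A C A C = dot A B A B + dot B C B C - 2 * dot B C B A)
      by (unfold dot; ring).
    rewrite E1, d1, d2, <- !distance_sqr, (distance_sym O C) in E2.
    assert (distance O A - distance C O = distance A B - distance B C) as E3 by lra.
    assert ((distance O A - distance C O) ^ 2 = (distance A B - distance B C) ^ 2)
      by now rewrite E3.
    lra. }
  subst k'.
  (* Cutting along [AC], twice the area is [4 * k * x + 4 * k * y]; it is also twice the perimeter,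
     hence four times the sum of two opposite sides. *)
  assert (Hsk : k * (x + y) = distance O A + distance B C).
  { assert (cross O A O C + cross B C B A = 2 * signed_area O A B C)
      by (unfold signed_area, cross; field).
    lra. }
  assert (Hk0 : 0 < k) by nra.
  assert (Hxy : 0 < x + y) by nra.
  assert (Hs : leq_sigma O A B C = k).
  { apply (sigma_eq O A B C k x y); try easy; lra. }
  exists x. rewrite Hs. cbv zeta.
  repeat split; try easy; try lra.
  - rewrite <- Hsk. f_equal. lra.
  - rewrite x3, Hk. easy.
Qed.

(** * Rational and integer reals *)

Definition rational (x : R) : Prop := exists q : Q, x = Q2R q.
Definition integer (x : R) : Prop := exists n : Z, x = IZR n.

Lemma integer_plus x y : integer x -> integer y -> integer (x + y).
Proof. intros [m ->] [n ->]; exists (m + n)%Z; now rewrite plus_IZR. Qed.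

Lemma integer_minus x y : integer x -> integer y -> integer (x - y).
Proof. intros [m ->] [n ->]; exists (m - n)%Z; now rewrite minus_IZR. Qed.

Lemma integer_mult x y : integer x -> integer y -> integer (x * y).
Proof. intros [m ->] [n ->]; exists (m * n)%Z; now rewrite mult_IZR. Qed.

Lemma integer_IZR n : integer (IZR n).
Proof. now exists n. Qed.

Lemma integer_rational x : integer x -> rational x.
Proof. intros [n ->]; exists (n # 1). unfold Q2R; simpl; field. Qed.

Lemma rational_plus x y : rational x -> rational y -> rational (x + y).
Proof. intros [m ->] [n ->]; exists (m + n)%Q; now rewrite Q2R_plus. Qed.

Lemma rational_minus x y : rational x -> rational y -> rational (x - y).
Proof. intros [m ->] [n ->]; exists (m - n)%Q; now rewrite Q2R_minus. Qed.

Lemma rational_mult x y : rational x -> rational y -> rational (x * y).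
Proof. intros [m ->] [n ->]; exists (m * n)%Q; now rewrite Q2R_mult. Qed.

Lemma rational_div x y : rational x -> rational y -> y <> 0 -> rational (x / y).
Proof.
  intros [m ->] [n ->] H; exists (m / n)%Q. rewrite Q2R_div; [easy|].
  intros E; apply H. rewrite (Qeq_eqR _ _ E). unfold Q2R; simpl; field.
Qed.

(** With [x = a / b] in lowest terms, [b * b] is prime to [a * a] and so divides [n]; the first
    hypothesis, squarefreeness of [n], then gives [b = 1]. *)
Lemma rational_squarefree_integer (n : Z) x :
  (forall q, (q * q | n)%Z -> (q * q = 1)%Z) ->
  rational x -> integer (IZR n * x ^ 2) -> integer x.
Proof.
  intros Hn [q ->] [m Hm].
  rewrite <- (Qeq_eqR _ _ (Qred_correct q)) in *.
  assert (Hg : Z.gcd (Qnum (Qred q)) (QDen (Qred q)) = 1%Z)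
    by (apply Qred_identity2, Qred_complete, Qred_correct).
  destruct (Qred q) as [a b]. simpl in Hg. unfold Q2R in *; simpl in *.
  assert (Hb : IZR (Z.pos b) <> 0) by (apply not_0_IZR; easy).
  assert (E : (n * (a * a) = m * (Z.pos b * Z.pos b))%Z).
  { apply eq_IZR. rewrite !mult_IZR, <- Hm. field; easy. }
  assert (Hr : rel_prime (Z.pos b * Z.pos b) (a * a)).
  { assert (rel_prime (Z.pos b) a).
    { apply rel_prime_sym, Zgcd_1_rel_prime, Hg. }
    apply rel_prime_mult; apply rel_prime_sym, rel_prime_mult; now apply rel_prime_sym. }
  assert (Hd : (Z.pos b * Z.pos b | n)%Z).
  { apply Gauss with (a * a)%Z; [|easy].
    exists m. rewrite <- E. ring. }
  apply Hn in Hd. assert (Z.pos b = 1%Z) as -> by nia.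
  exists a. field.
Qed.

Lemma squarefree_1_6_10 n q :
  (n = 1 \/ n = 6 \/ n = 10)%Z -> (q * q | n)%Z -> (q * q = 1)%Z.
Proof.
  intros Hn [k Hk].
  assert (q <> 0)%Z by (intros ->; lia).
  assert (0 < k)%Z by nia.
  assert (q * q <= 10)%Z by nia.
  assert (-3 <= q <= 3)%Z by nia.
  assert (q = -3 \/ q = -2 \/ q = -1 \/ q = 1 \/ q = 2 \/ q = 3)%Z as H3 by lia.
  destruct H3 as [-> | [-> | [-> | [-> | [-> | ->]]]]]; lia.
Qed.

(** The difference [x - y] is the quotient of [x ^ 2 - y ^ 2] by [x + y], so [x] is rational with
    integer square. The factor 4 matches twice the area, which is what is known to be an integer. *)
Lemma integer_of_sum_sqrt x y :
  0 < x -> 0 < y -> integer (x ^ 2) -> integer (y ^ 2) ->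
  integer (4 * (x + y)) -> integer x.
Proof.
  intros Hx Hy Ix Iy Is.
  apply (rational_squarefree_integer 1).
  - intros q; apply squarefree_1_6_10; lia.
  - replace x with ((4 * (x + y) / 4 + 4 * (x ^ 2 - y ^ 2) / (4 * (x + y))) / 2)
      by (field; lra).
    assert (R4 : rational 4) by apply integer_rational, integer_IZR.
    assert (R2 : rational 2) by apply integer_rational, integer_IZR.
    pose proof (integer_minus _ _ Ix Iy).
    repeat first [assumption | apply integer_rational; assumption
      | apply rational_plus | apply rational_div | apply rational_mult]; lra.
  - now rewrite Rmult_1_l.
Qed.

(** * Integrality of the incenter *)

(* Infinite descent: modulo 4 the three numbers m, n, l are even. *)
Lemma odd_point_descent (P Q : Z) :
  Z.Odd P -> Z.Odd Q ->
  forall N : nat, forall m n l : Z, (Z.abs l <= Z.of_nat N)%Z ->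
  (m * Q - n * P = 4 * l)%Z -> (m * m + n * n = l * l)%Z -> l = 0%Z.
Proof.
  intros [p ->] [q ->]. induction N as [|N IH]; intros m n l Hl H1 H2; [lia|].
  destruct (Z.Even_or_Odd m) as [[m' ->] | [m' ->]],
    (Z.Even_or_Odd n) as [[n' ->] | [n' ->]],
    (Z.Even_or_Odd l) as [[l' ->] | [l' ->]]; try (exfalso; lia).
  rewrite (IH m' n' l'); lia.
Qed.

Theorem corollary2 :
  forall O A B C : point,
    LEQ O A B C ->
    tangential O A B C ->
    In (leq_sigma O A B C) [2; 3; 5; 5 / 4; 3 / 2] ->
    In (leq_tau O A B C) [2; 3; 5; 5 / 4; 3 / 2] ->
    forall I : point, is_incenter O A B C I -> lattice_point I.
Proof.
  intros O A B C HL _ Hsig _ I HI.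
  destruct (incenter_relations O A B C I HL HI)
    as (t & Hs & Ha & Hc & Hpit & Hsum & Ht & Hcr & Hdt & Hii & Hre).
  destruct HL as (Hq & _ & (o1 & o2 & HO) & (a1 & a2 & HA) & (b1 & b2 & HB) & (c1 & c2 & HC) & _).
  destruct Hq as (_ & n2 & _ & n4 & _).
  destruct (not_collinear_distance _ _ _ n2) as [Hb _].
  destruct (not_collinear_distance _ _ _ n4) as [Hd _].
  clear n2 n4.
  assert (Hco : forall P, In P [O; A; B; C] -> integer (fst P) /\ integer (snd P)).
  { intros P [<- | [<- | [<- | [<- | []]]]]; subst; split; apply integer_IZR. }
  assert (HS : integer (2 * signed_area O A B C)).
  { unfold signed_area.
    match goal with |- integer (2 * (?e / 2)) => replace (2 * (e / 2)) with e by field end.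
    repeat first [apply integer_minus | apply integer_plus | apply integer_mult];
      apply Hco; simpl; tauto. }
  rewrite Hsum in HS.
  assert (Hdist : forall P Q, In P [O; A; B; C] -> In Q [O; A; B; C] ->
             integer (distance P Q ^ 2)).
  { intros P Q HP HQ. rewrite distance_sqr. unfold dot.
    repeat first [apply integer_minus | apply integer_plus | apply integer_mult];
      now apply Hco. }
  assert (Ia : integer (distance O A)).
  { apply integer_of_sum_sqrt with (distance B C); auto; apply Hdist; simpl; tauto. }
  rewrite Hpit in HS.
  assert (Ib : integer (distance A B)).
  { apply integer_of_sum_sqrt with (distance C O); auto; apply Hdist; simpl; tauto. }
  assert (Id : integer (distance C O)).
  { apply integer_of_sum_sqrt with (distance A B); auto;
      [apply Hdist; simpl; tauto.. | now rewrite Rplus_comm]. }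
  rewrite <- Hpit in HS.
  set (s := leq_sigma O A B C) in *. clearbody s.
  assert (Rs : rational s).
  { assert (Rn : forall n, rational (IZR n)) by (intros; apply integer_rational, integer_IZR).
    destruct Hsig as [<- | [<- | [<- | [<- | [<- | []]]]]];
      try apply rational_div; auto; lra. }
  assert (Hp1 : integer (fst A - fst O)) by (apply integer_minus; apply Hco; simpl; tauto).
  assert (Hp2 : integer (snd A - snd O)) by (apply integer_minus; apply Hco; simpl; tauto).
  assert (Hq1 : integer (fst C - fst O)) by (apply integer_minus; apply Hco; simpl; tauto).
  assert (Hq2 : integer (snd C - snd O)) by (apply integer_minus; apply Hco; simpl; tauto).
  pose proof (distance_sqr O A) as Haa.
  unfold dot, cross in Haa, Hcr, Hdt, Hii.
  set (a := distance O A) in *. set (d := distance C O) in *.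
  set (p1 := fst A - fst O) in *. set (p2 := snd A - snd O) in *.
  set (q1 := fst C - fst O) in *. set (q2 := snd C - snd O) in *.
  set (i1 := fst I - fst O) in *. set (i2 := snd I - snd O) in *.
  assert (R2 : rational 2) by apply integer_rational, integer_IZR.
  assert (Rt : rational t).
  (* This solves the relation [Ht] for [t], keeping the sum of opposite sides in the form
     [4 * (a + c)] known to be an integer. *)
  { replace t with ((4 * (a + distance B C) / (4 * s) + (a - distance A B)) / 2)
      by (rewrite <- Ht; field; lra).
    assert (rational 4) by apply integer_rational, integer_IZR.
    repeat first [assumption | apply integer_rational; assumption
      | apply rational_minus | apply rational_plus | apply rational_div
      | apply rational_mult]; lra. }
  assert (Na : a * a <> 0) by (apply Rgt_not_eq, Rmult_lt_0_compat; easy).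
  assert (R1 : rational i1).
  (* With origin [O], the dot and cross products of [A] and [I] give [I = A (t + 2i) / a] in complex
     notation; this is its real part, and [i2] is its imaginary part. *)
  { replace i1 with ((t * p1 - 2 * p2) / a).
    - repeat first [assumption | apply integer_rational; assumption
        | apply rational_div | apply rational_minus | apply rational_mult]; lra.
    - apply Rmult_eq_reg_r with (a * a); [|easy].
      replace (_ / a * (a * a)) with ((t * a) * p1 - (2 * a) * p2) by (field; lra).
      rewrite <- Hdt, <- Hcr. replace (a * a) with (a ^ 2) by ring. rewrite Haa. ring. }
  assert (R1' : rational i2).
  { replace i2 with ((t * p2 + 2 * p1) / a).
    - repeat first [assumption | apply integer_rational; assumption
        | apply rational_div | apply rational_plus | apply rational_mult]; lra.
    - apply Rmult_eq_reg_r with (a * a); [|easy].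
      replace (_ / a * (a * a)) with ((t * a) * p2 + (2 * a) * p1) by (field; lra).
      rewrite <- Hdt, <- Hcr. replace (a * a) with (a ^ 2) by ring. rewrite Haa. ring. }
  (* Adding and subtracting the modulus and real-part equations isolates the square of each
     coordinate. *)
  assert (K1 : integer (2 * s * i1 ^ 2)).
  { replace (2 * s * i1 ^ 2) with (a * d + (p1 * q1 - p2 * q2)) by lra.
    auto using integer_plus, integer_minus, integer_mult. }
  assert (K2 : integer (2 * s * i2 ^ 2)).
  { replace (2 * s * i2 ^ 2) with (a * d - (p1 * q1 - p2 * q2)) by lra.
    auto using integer_minus, integer_mult. }
  (* The factor [k] clears the denominator of [2 * s] and leaves a squarefree [n]. *)
  assert (Hsq : forall n k x, (n = 1 \/ n = 6 \/ n = 10)%Z -> rational x ->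
            integer (2 * s * x ^ 2) -> IZR n = IZR k * (2 * s) -> integer x).
  { intros n k x Hn Hx Hi E. apply (rational_squarefree_integer n); [|easy|].
    - intros q; now apply squarefree_1_6_10.
    - rewrite E, Rmult_assoc. apply integer_mult; [apply integer_IZR | easy]. }
  assert (Hgoal : integer i1 /\ integer i2).
  2:{ destruct Hgoal as [[m Hm] [n Hn]]. exists (o1 + m)%Z, (o2 + n)%Z.
      rewrite !plus_IZR, <- Hm, <- Hn. subst O. destruct I; unfold i1, i2; simpl.
      f_equal; ring. }
  destruct Hsig as [E | [E | [E | [E | [E | []]]]]].
  (* For [s = 2] the coefficient 4 is a square, so only the doubled coordinates [P], [Q] are
     integers at first. *)
  - destruct (rational_squarefree_integer 1 (2 * i1)) as [P HP].
    { intros q; apply squarefree_1_6_10; lia. }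
    { now apply rational_mult. }
    { replace (1 * (2 * i1) ^ 2) with (2 * s * i1 ^ 2) by (rewrite <- E; ring). easy. }
    destruct (rational_squarefree_integer 1 (2 * i2)) as [Q HQ].
    { intros q; apply squarefree_1_6_10; lia. }
    { now apply rational_mult. }
    { replace (1 * (2 * i2) ^ 2) with (2 * s * i2 ^ 2) by (rewrite <- E; ring). easy. }
    assert (Hhalf : forall x z, 2 * x = IZR (2 * z) -> integer x).
    { intros x z H; exists z; rewrite mult_IZR in H; lra. }
    destruct Hp1 as [m1 Hm1], Hp2 as [m2 Hm2], Ia as [l Hl].
    (* The real-part equation with [s = 2] makes [P * P - Q * Q] twice an integer, so [P] and [Q]
       have the same parity. *)
    assert (Hpar : exists z, (P * P - Q * Q = 2 * z)%Z).
    { destruct (integer_minus _ _ (integer_mult _ _ (ex_intro _ m1 Hm1) Hq1)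
                  (integer_mult _ _ (ex_intro _ m2 Hm2) Hq2)) as [z Hz].
      exists z. apply eq_IZR.
      rewrite minus_IZR, !mult_IZR, <- HP, <- HQ, <- Hz, Hre, <- E. ring. }
    assert (D1 : (m1 * Q - m2 * P = 4 * l)%Z).
    { apply eq_IZR. rewrite minus_IZR, !mult_IZR, <- HP, <- HQ, <- Hl, <- Hm1, <- Hm2. lra. }
    assert (D2 : (m1 * m1 + m2 * m2 = l * l)%Z).
    { apply eq_IZR. rewrite plus_IZR, !mult_IZR, <- Hl, <- Hm1, <- Hm2, <- Haa. ring. }
    destruct Hpar as [z Hz].
    destruct (Z.Even_or_Odd P) as [[P' ->] | OP], (Z.Even_or_Odd Q) as [[Q' ->] | OQ].
    + eauto.
    + exfalso. destruct OQ as [Q' ->]. lia.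
    + exfalso. destruct OP as [P' ->]. lia.
    + exfalso.
      assert (l = 0%Z) as -> by (apply (odd_point_descent P Q OP OQ (Z.abs_nat l) m1 m2 l); lia).
      lra.
  (* For [s] equal to 3, 5, 5/4, 3/2 the value [2 * s] is 6, 10, 10/4, 6/2. *)
  - split; (apply (Hsq 6%Z 1%Z); [lia | easy | easy | lra]).
  - split; (apply (Hsq 10%Z 1%Z); [lia | easy | easy | lra]).
  - split; (apply (Hsq 10%Z 4%Z); [lia | easy | easy | lra]).
  - split; (apply (Hsq 6%Z 2%Z); [lia | easy | easy | lra]).
Qed.
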